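(* Let $\Theta\subseteq\mathbb{R}$ be an interval and let $g:\Theta\to\mathbb{R}$ be a continuous non-linear function such that the equation $g(\theta)=0$, $\theta\in\Theta$, has a unique root $\theta^*$, with $g(\theta)>0$ for all $\theta<\theta^*$ and $g(\theta)<0$ for all $\theta>\theta^*$ ($\theta\in\Theta$). Let $U(\theta|\theta^{(t)})$ be a $U$-function for $g(\theta)$ at $\theta=\theta^{(t)}$ in $\Theta$. For any initial value $\theta^{(0)}$ in $\Theta$, if $$|U(\theta_1|\theta^{(t)})-U(\theta_2|\theta^{(t)})|<L\,|\theta_1-\theta_2|$$ for any (distinct) $\theta_1$ and $\theta_2$ located between $\theta^{(0)}$ and $\theta^*$, where $L$ is a Lipschitz constant relying on $\theta^{(0)}$, $\theta^*$ and $U(\theta|\theta^{(t)})$, then the sequence $\{\theta^{(t+1)}\}_{t=0}^\infty$ specified by $$\theta^{(t+1)}=\text{the solution in }\theta\in\Theta\text{ of the equation }U(\theta|\theta^{(t)})=0$$ strongly stably converges to $\theta^*$.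
   Context: $U$-function: for a point $\theta^{(t)}\in\Theta$ (the $t$-th iterate), a real-valued function $U(\theta|\theta^{(t)})$ of $\theta\in\Theta$, whose form depends on $\theta^{(t)}$, is called a $U$-function for $g$ at $\theta=\theta^{(t)}$ if $g(\theta)\le U(\theta|\theta^{(t)})$ for $\theta<\theta^{(t)}$, $g(\theta^{(t)})=U(\theta^{(t)}|\theta^{(t)})$, and $g(\theta)\ge U(\theta|\theta^{(t)})$ for $\theta>\theta^{(t)}$. Strongly stable convergence: a sequence $\{\theta^{(t)}\}_{t=0}^\infty$ is said to strongly stably converge to a fixed point $\theta^*$ if $$\theta^{(0)}<\theta^{(1)}<\cdots<\theta^{(t)}<\cdots\le\theta^*\quad\text{or}\quad\theta^*\le\cdots<\theta^{(t)}<\cdots<\theta^{(1)}<\theta^{(0)}.$$ The iteration defining $\theta^{(t+1)}$ from $\theta^{(t)}$ is called the upper-crossing/solution (US) algorithm.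
   Formalization: The strict chain fails once an iterate equals θ* (e.g. U=g gives θ(1)=θ(2)=θ* ), so strict progress is required only until θ* is reached, then constancy; convergence to θ* is also proved, with one L for all t and ''between'' read as the closed segment. *)

(* Defs.v *)
From HB Require Import structures.
From mathcomp Require Import all_boot all_order all_algebra.
From mathcomp Require Import all_classical all_reals all_analysis.
Set Implicit Arguments.
Unset Strict Implicit.
Unset Printing Implicit Defensive.
Import Order.TTheory GRing.Theory Num.Theory.
Import numFieldNormedType.Exports.
Local Open Scope classical_set_scope.
Local Open Scope ring_scope.

(* Functions on Theta are represented by total functions R -> R, of which only
   the values on Theta are ever used.  A two-argument U : R -> R -> R stands
   for U(x | c), written U x c. *)

Definition affine_on (R : realType) (Theta : set R) (g : R -> R) : Prop :=
  exists a b : R, forall x, Theta x -> g x = a * x + b.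

Definition U_function (R : realType) (Theta : set R) (g : R -> R) (c : R)
    (u : R -> R) : Prop :=
  [/\ forall x, Theta x -> x < c -> g x <= u x,
      g c = u c &
      forall x, Theta x -> c < x -> u x <= g x].

Definition between (R : realType) (a b x : R) : Prop :=
  a <= x <= b \/ b <= x <= a.

Definition US_solution (R : realType) (Theta : set R) (U : R -> R -> R)
    (c y : R) : Prop :=
  Theta y /\ U y c = 0.

(* The next iterate is a solution of U(. | theta t) = 0 as soon as there is
   one; nothing is assumed about it otherwise, so that solvability at every
   step is something to be proved, not part of the definition.  If there are
   several solutions, any of them may be selected. *)
Definition US_sequence (R : realType) (Theta : set R) (U : R -> R -> R)
    (theta : nat -> R) : Prop :=
  forall t : nat, (exists y, US_solution Theta U (theta t) y) ->
    US_solution Theta U (theta t) (theta t.+1).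

(* theta 0 < theta 1 < ... <= thetas, or the mirror image, together with
   convergence.  A strict chain cannot continue once an iterate equals the
   fixed point thetas (for instance, U(x | c) = g x gives theta 1 = thetas and
   then theta 2 = thetas): from there on the sequence is required to stay at
   thetas.  If no iterate equals thetas, the chain is strict throughout. *)
Definition strongly_stably_converges (R : realType) (theta : nat -> R)
    (thetas : R) : Prop :=
  ((forall t : nat, theta t < theta t.+1 <= thetas
                    \/ (theta t = thetas /\ theta t.+1 = thetas)) \/
   (forall t : nat, thetas <= theta t.+1 < theta t
                    \/ (theta t = thetas /\ theta t.+1 = thetas)))
  /\ theta @ \oo --> thetas.

(* Main.v *)
(* The sign conditions on g, transferred to U by the crossing property, force
   every root of U(. | c), for c <> thetas, to lie strictly past c towards thetas
   and not beyond it, and the intermediate value theorem provides one.  The iterates are thus monotone and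
   bounded; since g(theta t) = U(theta t | theta t) - U(theta t.+1 | theta t) is
   at most L * |theta t - theta t.+1|, which tends to 0, g vanishes at their
   limit, which is therefore thetas. *)

Require Import Defs.
From HB Require Import structures.
From mathcomp Require Import all_boot all_order all_algebra.
From mathcomp Require Import all_classical all_reals all_analysis.
Set Implicit Arguments.
Unset Strict Implicit.
Import Order.TTheory GRing.Theory Num.Theory.
Import numFieldNormedType.Exports.
Local Open Scope classical_set_scope.
Local Open Scope ring_scope.

(** The bound makes [u] continuous on the segment, so the intermediate value theorem applies.
    Continuity comes from [L * |x - y|] tending to 0 as [y] tends to [x], which works for [L] of any
    sign. *)
Lemma lipschitz_segment_root (R : realType) (u : R -> R) (L a b : R) :
  a <= b ->
  (forall x y, a <= x <= b -> a <= y <= b -> `|u x - u y| <= L * `|x - y|) ->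
  0 <= u a -> u b <= 0 -> exists2 y, a <= y <= b & u y = 0.
Proof.
move=> ab lip ua ub.
have cu : {within `[a, b], continuous u}.
  apply/subspace_continuousP => x /= xab.
  have dist0 : L * `|x - y| @[y --> within `[a, b]%classic (nbhs x)] --> (0 : R).
    have -> : 0 = L * `|x - x| by rewrite subrr normr0 mulr0.
    apply: (@cvg_within_filter _ _ _ (nbhs x)).
    by apply: cvgM; [exact: cvg_cst|]; apply: cvg_norm; apply: cvgB;
      [exact: cvg_cst|exact: cvg_id].
  apply/cvgrPdist_le => e e0.
  move/cvgrPdist_le : dist0 => /(_ e e0) near_e.
  apply: filterS2 near_e (withinT _ (nbhs_filter x)) => y.
  rewrite sub0r normrN => near_y yab; apply: (le_trans (lip _ _ _ _)).
  - by move: xab; rewrite in_itv.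
  - by move: yab; rewrite /= in_itv.
  - exact: le_trans (ler_norm _) near_y.
have [|y yab uy] := IVT ab cu (v := 0); first by rewrite ge_min le_max ub ua orbT.
by exists y => //; move: yab; rewrite in_itv.
Qed.

(** Continuity within [A] only controls [g] along points of [A] near [l]; a sequence that stays in
    [A] sees no others. *)
Lemma within_continuous_cvg_seq (R : realType) (A : set R) (g : R -> R)
    (u : nat -> R) (l : R) :
  {within A, continuous g} -> (forall n, A (u n)) -> A l -> u @ \oo --> l ->
  (g \o u) @ \oo --> g l.
Proof.
move=> /subspace_continuousP cg Au Al ul.
apply: cvg_comp (cg l Al) => B wB.
have uB : \forall n \near \oo, A (u n) -> B (u n) := ul _ wB.
change (\forall n \near \oo, B (u n)).
by apply: filterS uB => n; apply; exact: Au.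
Qed.

Section Step.
Context (R : realType) (Theta : set R) (g : R -> R) (thetas : R)
  (U : R -> R -> R).
Hypothesis Theta_thetas : Theta thetas.
Hypothesis g_thetas : g thetas = 0.
Hypothesis g_pos : forall x, Theta x -> x < thetas -> 0 < g x.
Hypothesis g_neg : forall x, Theta x -> thetas < x -> g x < 0.
Hypothesis U_fun : forall c, Theta c -> U_function Theta g c (fun x => U x c).

(** Each other position of [y] contradicts a sign of [g]: [y = c] gives [g c = 0], [y < c] gives
    [g y <= 0] to the left of [thetas], and [thetas < y] gives [0 <= g y]. *)
Lemma US_solution_lt c y : Theta c -> c < thetas ->
  US_solution Theta U c y -> c < y <= thetas.
Proof.
move=> Tc cs [Ty Uy]; have [Ul Uc Ur] := U_fun Tc.
have cy : c < y.
  rewrite ltNge le_eqVlt; apply/negP => /orP[/eqP yc|yc].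
    by have := g_pos Tc cs; rewrite Uc -[X in U X]yc Uy ltxx.
  have := Ul _ Ty yc; rewrite Uy leNgt => /negP; apply.
  exact: g_pos Ty (lt_trans yc cs).
rewrite cy leNgt /=; apply/negP => sy.
by have := Ur _ Ty cy; rewrite Uy leNgt g_neg.
Qed.

Lemma US_solution_gt c y : Theta c -> thetas < c ->
  US_solution Theta U c y -> thetas <= y < c.
Proof.
move=> Tc sc [Ty Uy]; have [Ul Uc Ur] := U_fun Tc.
have yc : y < c.
  rewrite ltNge le_eqVlt; apply/negP => /orP[/eqP cy|cy].
    by have := g_neg Tc sc; rewrite Uc [X in U X]cy Uy ltxx.
  have := Ur _ Ty cy; rewrite Uy leNgt => /negP; apply.
  exact: g_neg Ty (lt_trans sc cy).
rewrite yc andbT leNgt; apply/negP => ys.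
by have := Ul _ Ty yc; rewrite Uy leNgt g_pos.
Qed.

(** This keeps the iteration at [thetas] once it is reached: on either side, the crossing property
    at [thetas] would give [g y] the wrong sign. *)
Lemma US_solution_eq y : US_solution Theta U thetas y -> y = thetas.
Proof.
move=> [Ty Uy]; have [Ul _ Ur] := U_fun Theta_thetas.
case: (ltgtP y thetas) => // h.
  by have := Ul _ Ty h; rewrite Uy leNgt g_pos.
by have := Ur _ Ty h; rewrite Uy leNgt g_neg.
Qed.

(** Here [a] plays the role of the initial iterate. Since [c] lies between [a] and [thetas], the
    Lipschitz bound covers the segment from [c] to [thetas]. There [U x c] changes sign: it equals
    [g c] at [c], and at [thetas] the crossing property compares it with [g thetas = 0]. *)
Lemma US_solution_exists (L a c : R) : is_interval Theta ->
  Theta c -> between a thetas c ->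
  (forall x y, between a thetas x -> between a thetas y -> x <> y ->
     `|U x c - U y c| < L * `|x - y|) ->
  exists y, US_solution Theta U c y.
Proof.
move=> iT Tc ac lip; have [Ul Uc Ur] := U_fun Tc.
(* The strict bound is given for distinct points only; at [x = y] both sides vanish, so the weak
   form holds everywhere. *)
have lip' x y : between a thetas x -> between a thetas y ->
    `|U x c - U y c| <= L * `|x - y|.
  move=> ax ay; have [->|/eqP xy] := eqVneq x y.
    by rewrite !subrr normr0 mulr0.
  exact/ltW/lip.
case: (ltgtP c thetas) => [cs|sc|->]; last first.
- by exists thetas; split=> //; have [_ <- _] := U_fun Theta_thetas.
- have ca : c <= a.
    by case: ac => /andP[h1 h2] //; have := lt_le_trans sc h2; rewrite ltxx.
  have btw x : thetas <= x <= c -> between a thetas x.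
    by move=> /andP[sx xc]; right; rewrite sx (le_trans xc ca).
  have [||||y yI Uy] := @lipschitz_segment_root R (U^~ c) L thetas c.
  + exact: ltW.
  + by move=> x y /btw ? /btw ?; exact: lip'.
  + by rewrite -g_thetas; exact: Ul.
  + by rewrite -Uc; apply/ltW/g_neg.
  by exists y; split=> //; exact: iT yI.
- have ca : a <= c.
    by case: ac => /andP[h1 h2] //; have := lt_le_trans cs h1; rewrite ltxx.
  have btw x : c <= x <= thetas -> between a thetas x.
    by move=> /andP[cx xs]; left; rewrite xs (le_trans ca cx).
  have [||||y yI Uy] := @lipschitz_segment_root R (U^~ c) L c thetas.
  + exact: ltW.
  + by move=> x y /btw ? /btw ?; exact: lip'.
  + by rewrite -Uc; apply/ltW/g_pos.
  + by rewrite -[leRHS]g_thetas; exact: Ur.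
  by exists y; split=> //; exact: iT yI.
Qed.

End Step.

(** Consecutive terms have the same limit, so the bound squeezes [g (u n)] to 0, while continuity
    sends it to [g l]. *)
Lemma cvg_root_of_increment_bound (R : realType) (A : set R) (g : R -> R)
    (u : nat -> R) (L l : R) :
  {within A, continuous g} -> (forall n, A (u n)) -> A l -> u @ \oo --> l ->
  (forall n, `|g (u n)| <= L * `|u n - u n.+1|) -> g l = 0.
Proof.
move=> cg Au Al ul gu.
have gul := within_continuous_cvg_seq cg Au Al ul.
have incr0 : (fun n => L * `|u n - u n.+1|) @ \oo --> (0 : R).
  have -> : 0 = L * `|l - l| by rewrite subrr normr0 mulr0.
  apply: cvgM; [exact: cvg_cst|]; apply: cvg_norm; apply: cvgB => //.
  by have := ul; rewrite -cvg_shiftS.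
have gu0 : (g \o u) @ \oo --> (0 : R).
  apply/norm_cvg0P; apply: (squeeze_cvgr _ (cvg_cst 0) incr0).
  by near=> n; rewrite normr_ge0 gu.
exact: (cvg_unique _ gul gu0).
Unshelve. all: by end_near. Qed.

Theorem theorem1 (R : realType) (Theta : set R) (g : R -> R) (thetas : R)
  (U : R -> R -> R)
  (Theta_interval : is_interval Theta)
  (g_continuous : {within Theta, continuous g})
  (g_nonlinear : ~ affine_on Theta g)
  (g_root : [set x | Theta x /\ g x = 0] = [set thetas])
  (g_pos : forall x, Theta x -> x < thetas -> 0 < g x)
  (g_neg : forall x, Theta x -> thetas < x -> g x < 0)
  (U_fun : forall c, Theta c -> U_function Theta g c (fun x => U x c))
  (theta : nat -> R)
  (theta0_in : Theta (theta 0%N))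
  (theta_US : US_sequence Theta U theta)
  (L : R)
  (U_lipschitz : forall (t : nat) (x1 x2 : R),
     between (theta 0%N) thetas x1 -> between (theta 0%N) thetas x2 ->
     x1 <> x2 ->
     `|U x1 (theta t) - U x2 (theta t)| < L * `|x1 - x2|) :
  (forall t : nat, US_solution Theta U (theta t) (theta t.+1)) /\
  strongly_stably_converges theta thetas.
Proof.
have [Ts gs] : Theta thetas /\ g thetas = 0.
  by have : [set thetas] thetas by []; rewrite -g_root.
have Theta_btw x : between (theta 0%N) thetas x -> Theta x.
  by case; [exact: Theta_interval|exact: Theta_interval].
(* Solvability at [theta t] requires [theta t] to lie in the initial segment, and staying in that
   segment requires solvability; hence this conditional form, discharged by the induction in
   [inv]. *)
have step t : between (theta 0%N) thetas (theta t) ->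
    US_solution Theta U (theta t) (theta t.+1).
  move=> bt; apply: theta_US.
  exact: (US_solution_exists Ts gs g_pos g_neg U_fun Theta_interval
    (Theta_btw _ bt) bt (U_lipschitz t)).
have inv t : between (theta 0%N) thetas (theta t).
  elim: t => [|t bt].
    by case: (leP (theta 0%N) thetas) => [h|/ltW h]; [left|right]; rewrite lexx h.
  have sol := step _ bt; have Tt := Theta_btw _ bt.
  case: (ltgtP (theta t) thetas) => [lts|gts|eqs].
  - have /andP[h1 h2] := US_solution_lt g_pos g_neg U_fun Tt lts sol.
    case: bt => /andP[h3 h4]; last by have := lt_le_trans lts h3; rewrite ltxx.
    by left; rewrite h2 (le_trans h3 (ltW h1)).
  - have /andP[h1 h2] := US_solution_gt g_pos g_neg U_fun Tt gts sol.
    case: bt => /andP[h3 h4]; first by have := lt_le_trans gts h4; rewrite ltxx.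
    by right; rewrite h1 (le_trans (ltW h2) h4).
  - move: sol; rewrite eqs => /(US_solution_eq Ts g_pos g_neg U_fun) ->.
    by rewrite -[X in between _ _ X]eqs.
have sol t := step t (inv t).
have Tt t := Theta_btw _ (inv t).
split=> //.
(* [Theta] may fail to be closed; a limit in the initial segment is certain to belong to it. *)
have limE l : between (theta 0%N) thetas l -> theta @ \oo --> l -> l = thetas.
  move=> /Theta_btw Tl tl.
  suff gl : g l = 0 by have : [set x | Theta x /\ g x = 0] l by []; rewrite g_root.
  apply: (cvg_root_of_increment_bound (L := L) g_continuous Tt Tl tl) => t.
  have [_ -> _] := U_fun _ (Tt t).
  (* A subtracted 0 is replaced by the value of [U] at the next iterate, turning [g (theta t)] into
     an increment of [U]. *)
  have [_ U0] := sol t; rewrite -[X in `|X|]subr0 -U0.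
  have [e|/eqP ne] := eqVneq (theta t) (theta t.+1).
    by rewrite -e !subrr normr0 mulr0.
  exact/ltW/U_lipschitz.
case: (leP (theta 0%N) thetas) => [le0|gt0].
(* This case includes [theta 0 = thetas]; the second alternative of [inv] then forces all three
   points to coincide. *)
- have bnd t : theta 0%N <= theta t <= thetas.
    by case: (inv t) => /andP[h1 h2]; rewrite ?h1 ?h2 //
      (le_trans h2 le0) (le_trans le0 h1).
  have chain t : theta t < theta t.+1 <= thetas
      \/ (theta t = thetas /\ theta t.+1 = thetas).
    have /andP[_] := bnd t; rewrite le_eqVlt => /orP[/eqP e|lts].
      right; split=> //; have := sol t; rewrite e.
      exact: (US_solution_eq Ts g_pos g_neg U_fun).
    by left; exact: (US_solution_lt g_pos g_neg U_fun (Tt t) lts (sol t)).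
  split; first by left.
  have nd : nondecreasing_seq theta.
    by apply/nondecreasing_seqP => t; case: (chain t) => [/andP[/ltW]|[-> ->]].
  have ct : cvgn theta.
    apply: nondecreasing_is_cvgn nd _; exists thetas => _ [t _ <-].
    by have /andP[] := bnd t.
  (* The weak bounds [bnd] pass to the limit and place it in the segment, as [limE] demands. *)
  rewrite -(limE (limn theta)) //; left; apply/andP; split.
    by apply: limr_ge => //; apply: nearW => t; have /andP[] := bnd t.
  by apply: limr_le => //; apply: nearW => t; have /andP[] := bnd t.
- have bnd t : thetas <= theta t <= theta 0%N.
    case: (inv t) => /andP[h1 h2]; last by rewrite h1 h2.
    by have := lt_le_trans gt0 (le_trans h1 h2); rewrite ltxx.
  have chain t : thetas <= theta t.+1 < theta t
      \/ (theta t = thetas /\ theta t.+1 = thetas).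
    have /andP[+ _] := bnd t; rewrite le_eqVlt => /orP[/eqP e|gts].
      right; split=> //; have := sol t; rewrite -e.
      exact: (US_solution_eq Ts g_pos g_neg U_fun).
    by left; exact: (US_solution_gt g_pos g_neg U_fun (Tt t) gts (sol t)).
  split; first by right.
  have ni : nonincreasing_seq theta.
    by apply/nonincreasing_seqP => t; case: (chain t) => [/andP[_ /ltW]|[-> ->]].
  have ct : cvgn theta.
    apply: nonincreasing_is_cvgn ni _; exists thetas => _ [t _ <-].
    by have /andP[] := bnd t.
  rewrite -(limE (limn theta)) //; right; apply/andP; split.
    by apply: limr_ge => //; apply: nearW => t; have /andP[] := bnd t.
  by apply: limr_le => //; apply: nearW => t; have /andP[] := bnd t.
Qed.
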